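(* Let $\mathcal{K}$ be a finite index set (the base stations) and let $\mathcal{N}\subseteq\mathcal{K}$ be a nonempty subset (the cooperating base stations). For each $n\in\mathcal{K}$ let $P_n>0$, and assume that the values $P_n$, $n\in\mathcal{N}$, are pairwise distinct. Let $(h_n)_{n\in\mathcal{K}}$ be independent circularly symmetric complex Gaussian random variables with $\mathbb{E}[h_n]=0$ and $\mathbb{E}|h_n|^2=1$, so that $H_n:=|h_n|^2P_n$ are independent exponential random variables with means $P_n$. Let $\sigma_z^2\ge 0$ and define the SINR $$\gamma(\mathcal{N})=\frac{\sum_{n\in\mathcal{N}}|h_n|^2P_n}{\sum_{k\in\mathcal{K}\setminus\mathcal{N}}|h_k|^2P_k+\sigma_z^2}$$ (when $\sigma_z^2=0$ and $\mathcal{K}\setminus\mathcal{N}=\emptyset$ the statement is not considered). Then for every threshold $\gamma_{th}>0$, the outage probability $P^{out}_{\mathcal{N}}(\gamma_{th}):=\mathbb{P}\big(\gamma(\mathcal{N})\le\gamma_{th}\big)$ equals $$P^{out}_{\mathcal{N}}(\gamma_{th})=1-\sum_{n\in\mathcal{N}}\left(e^{-\gamma_{th}\sigma_z^2/P_n}\prod_{j\in\mathcal{N},\,j\neq n}\frac{P_n}{P_n-P_j}\prod_{k\in\mathcal{K}\setminus\mathcal{N}}\frac{P_n}{P_k\gamma_{th}+P_n}\right).$$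
   Context: Model: a mobile receives a joint (coordinated multipoint) downlink transmission from the base stations in $\mathcal{N}$, while base stations in $\mathcal{K}\setminus\mathcal{N}$ act as interferers. $P_n$ is the average received power from base station $n$ (transmit power times path gain), $h_n$ is the Rayleigh fast-fading coefficient, and $\sigma_z^2$ is the thermal noise power. An empty product is equal to $1$. *)

(* Defs.v *)
From HB Require Import structures.
From mathcomp Require Import all_boot all_order all_algebra.
From mathcomp Require Import all_classical all_reals all_analysis.
Set Implicit Arguments. Unset Strict Implicit. Unset Printing Implicit Defensive.
Import Order.TTheory GRing.Theory Num.Theory.
Local Open Scope classical_set_scope.
Local Open Scope ring_scope.

(* Mutual independence of a finite family of real random variables:
   product rule for every family of Borel sets (the standard definition;
   sub-families are obtained by taking B i = setT). *)
Definition mutually_independent_RV {d} {T : measurableType d} {R : realType}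
  (P : probability T R) (I : finType) (X : I -> {RV P >-> R}) : Prop :=
  forall B : I -> set R, (forall i, measurable (B i)) ->
    P (\bigcap_(i in [set: I]) (X i @^-1` B i)) =
    (\prod_(i : I) P (X i @^-1` B i))%E.

(* X has the real Gaussian law N(m, s^2) (s = standard deviation). *)
Definition has_normal_law {d} {T : measurableType d} {R : realType}
  (P : probability T R) (X : {RV P >-> R}) (m s : R) : Prop :=
  forall A : set R, measurable A -> distribution P X A = normal_prob m s A.

(* h_n = X (n,true) + i X (n,false): circularly symmetric complex Gaussian with
   E h = 0 and E|h|^2 = 1  <=>  real and imaginary parts are independent
   N(0, 1/2). |h_n|^2 = X(n,true)^2 + X(n,false)^2. *)
Definition abs2_h {d} {T : measurableType d} {R : realType}
  (P : probability T R) (K : finType) (X : (K * bool)%type -> {RV P >-> R})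
  (n : K) (w : T) : R := X (n, true) w ^+ 2 + X (n, false) w ^+ 2.

Definition sinr {d} {T : measurableType d} {R : realType}
  (P : probability T R) (K : finType) (X : (K * bool)%type -> {RV P >-> R})
  (Pw : K -> R) (N : {set K}) (sigma2 : R) (w : T) : R :=
  (\sum_(n in N) abs2_h X n w * Pw n) /
  (\sum_(k in ~: N) abs2_h X k w * Pw k + sigma2).

(* Main.v *)
Require Import Defs.
From HB Require Import structures.
From mathcomp Require Import all_boot all_order all_algebra.
From mathcomp Require Import all_classical all_reals all_analysis.
From mathcomp Require Import measurable_realfun ring lra.
Set Implicit Arguments. Unset Strict Implicit. Unset Printing Implicit Defensive.
Import Order.TTheory GRing.Theory Num.Theory.
Import numFieldNormedType.Exports.
Local Open Scope classical_set_scope.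
Local Open Scope ring_scope.

(** Up to the null event of a vanishing denominator, there is no outage iff
    [S > c], where [c = gth * sigma2] and [S] is the sum of the [a_k |h_k|^2]
    with [a_k = Pw k] on [N] and [a_k = - gth * Pw k] off [N]. The variables
    are added one at a time. If [S] is independent of [h = X + iY], polar
    coordinates give
      [P (S + a |h|^2 > c) = \int_0^oo P (S > c - a x^2) 2 x e^(-x^2) dx],
    so that the tail of [S] at [c >= 0] stays a linear combination of the
    exponentials [e^(- c / Pw n)], [n \in N]. A new weight [a > 0] multiplies
    the old coefficients by [Pw n / (Pw n - a)] and adds [e^(- c / a)], with a
    coefficient making the total equal to 1; Lagrange interpolation of the
    constant 1 identifies it. A new weight [- b <= 0] multiplies the
    coefficients by [Pw n / (b + Pw n)]. *)

(** * Lebesgue integrals: scaling, normal densities, polar coordinates *)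

(** By uniqueness of Lebesgue measure, half-open intervals suffice: the preimage of []x, y]] is []x
    / a, y / a]], and the factor [a] restores the length [y - x]. *)
Lemma lebesgue_measureM (R : realType) (a : R) (A : set R) :
  0 < a -> measurable A ->
  lebesgue_measure A =
  (a%:E * pushforward lebesgue_measure
     ( *%R a : measurableTypeR R -> measurableTypeR R) A)%E.
Proof.
move=> a0 mA.
have ma : measurable_fun setT
  ( *%R a : measurableTypeR R -> measurableTypeR R).
  exact: measurable_funM.
have @m : {measure set (measurableTypeR R) -> \bar R}.
  refine (mscale (NngNum (ltW a0)) (pushforward lebesgue_measure
    ( *%R a : measurableTypeR R -> measurableTypeR R))).
  exact: ma.
rewrite (_ : (_ * _)%E = m A)//.
apply: lebesgue_measure_unique => //= _ [[x y]] _ <-.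
rewrite /m /mscale/= /pushforward.
rewrite (_ : _ @^-1` _ = `]x / a, y / a]%classic); last first.
  apply/seteqP; split => z /=; rewrite !in_itv/= ltr_pdivrMr// ler_pdivlMr//;
    by rewrite mulrC.
rewrite !lebesgue_measure_itv/= !lte_fin ltr_pM2r ?invr_gt0//.
case: ifPn => _; last by rewrite mule0.
by rewrite -!EFinB -EFinM -mulrBl mulrCA divff ?mulr1// gt_eqF.
Qed.

Lemma ge0_integral_scale (R : realType) (a : R) (f : R -> \bar R) :
  0 < a -> measurable_fun [set: R] f -> (forall x, 0 <= f x)%E ->
  (\int[lebesgue_measure]_x f x =
   a%:E * \int[lebesgue_measure]_x f (a * x)%R)%E.
Proof.
move=> a0 mf f0.
have ma : measurable_fun setT
  ( *%R a : measurableTypeR R -> measurableTypeR R).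
  exact: measurable_funM.
have @m : {measure set (measurableTypeR R) -> \bar R}.
  refine (mscale (NngNum (ltW a0)) (pushforward lebesgue_measure
    ( *%R a : measurableTypeR R -> measurableTypeR R))).
  exact: ma.
transitivity (\int[m]_x f x)%E.
  apply: eq_measure_integral => /= A mA _.
  by rewrite (lebesgue_measureM a0 mA).
rewrite ge0_integral_mscale//= ge0_integral_pushforward//.
Qed.

(** The density is a.e. equal to the Radon-Nikodym derivative of [normal_prob m s], as both have the
    same integral over every measurable set; change of variables for the derivative then transfers
    to the density. *)
Lemma ge0_integral_normal (R : realType) (m s : R) (f : R -> \bar R) :
  measurable_fun [set: R] f -> (forall x, 0 <= f x)%E ->
  (\int[normal_prob m s]_x f x =
   \int[lebesgue_measure]_x (f x * (normal_pdf m s x)%:E))%E.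
Proof.
move=> mf f0.
have dom := normal_prob_dominates m s.
rewrite -(Radon_Nikodym_SigmaFinite.change_of_variables dom)//=.
apply: ae_eq_integral => //.
- apply: emeasurable_funM => //; apply: (measurable_int lebesgue_measure).
  exact: Radon_Nikodym_SigmaFinite.f_integrable.
- apply: emeasurable_funM => //; apply/measurable_EFinP.
  exact: measurable_normal_pdf.
- apply: ae_eqe_mul2l => /=; apply: integral_ae_eq => //=.
  + exact: Radon_Nikodym_SigmaFinite.f_integrable.
  + by apply/measurable_EFinP; exact: measurable_normal_pdf.
  + by move=> E _ mE; rewrite -Radon_Nikodym_SigmaFinite.f_integral.
Qed.

(* Polar coordinates from one-dimensional substitutions: put [y = |x| t],
   exchange the integrals, then rescale [x] by [sqrt (1 + t ^+ 2)]. *)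
Lemma ge0_integral_sqr_add (R : realType) (h : R -> \bar R) :
  measurable_fun [set: R] h -> (forall x, 0 <= h x)%E ->
  (\int[lebesgue_measure]_x \int[lebesgue_measure]_y h (x ^+ 2 + y ^+ 2)%R =
   (\int[lebesgue_measure]_t ((1 + t ^+ 2)^-1)%:E) *
   \int[lebesgue_measure]_x (`|x|%:E * h (x ^+ 2)%R))%E.
Proof.
move=> mh h0; set mu := lebesgue_measure.
have msqr : measurable_fun [set: R] (fun x : R => x ^+ 2).
  exact: measurable_funX.
have mh2 (a : R) : measurable_fun [set: R] (fun x => h (a * x ^+ 2)).
  by apply: measurableT_comp => //; exact: measurable_funM.
have mhD (a : R) : measurable_fun [set: R] (fun x => h (a + x ^+ 2)).
  by apply: measurableT_comp => //; exact: measurable_funD.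
have mf1 : measurable_fun [set: R * R]
    (fun z : R * R => h (z.1 ^+ 2 + z.2 ^+ 2)).
  apply: measurableT_comp => //; apply: measurable_funD;
    exact: measurableT_comp msqr _.
have mf2 : measurable_fun [set: R * R]
    (fun z : R * R => `|z.1|%:E * h (z.1 ^+ 2 * (1 + z.2 ^+ 2))%R)%E.
  apply: emeasurable_funM.
    by apply/measurable_EFinP; apply: measurableT_comp => //.
  apply: measurableT_comp => //; apply: measurable_funM.
    exact: measurableT_comp msqr _.
  apply: measurable_funD => //; exact: measurableT_comp msqr _.
have mf3 : measurable_fun [set: R] (fun x => `|x|%:E * h (x ^+ 2)%R)%E.
  apply: emeasurable_funM.
    by apply/measurable_EFinP => /=; apply: normr_measurable.
  exact: measurableT_comp.
have f20 z : (0 <= `|z.1|%:E * h (z.1 ^+ 2 * (1 + z.2 ^+ 2))%R)%E.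
  by rewrite mule_ge0// lee_fin.
transitivity (\int[mu]_x \int[mu]_t (`|x|%:E * h (x ^+ 2 * (1 + t ^+ 2))%R))%E.
  (* The substitution [y = |x| t] requires [x != 0], so the null point 0 is removed from both outer
     integrals. *)
  rewrite -(@integral_setD1 _ _ 0)//; last 2 first.
  - exact: measurableD.
  - apply: measurable_funTS.
    exact: (@measurable_fun_fubini_tonelli_F _ _ _ _ _ mu _ mf1 (fun=> h0 _)).
  rewrite -[RHS](@integral_setD1 _ _ 0)//; last 2 first.
  - exact: measurableD.
  - apply: measurable_funTS.
    exact: (@measurable_fun_fubini_tonelli_F _ _ _ _ _ mu _ mf2 f20).
  apply: eq_integral => x; rewrite inE => -[_ /= /eqP x0].
  rewrite ge0_integralZl//; last first.
    apply: measurableT_comp => //; apply: measurable_funM => //.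
    exact: measurable_funD.
  rewrite (@ge0_integral_scale _ `|x|) ?normr_gt0//.
  congr (_ * _)%E; apply: eq_integral => t _; congr h.
  by rewrite exprMn real_normK ?num_real//; ring.
rewrite [LHS](@fubini_tonelli _ _ _ _ _ mu mu _ mf2 f20)/=.
transitivity (\int[mu]_t ((1 + t ^+ 2)^-1%:E *
    \int[mu]_x (`|x|%:E * h (x ^+ 2)%R)))%E.
  apply: eq_integral => t _.
  have t0 : 0 < 1 + t ^+ 2 by rewrite ltr_pwDl// sqr_ge0.
  rewrite [in RHS](@ge0_integral_scale _ (Num.sqrt (1 + t ^+ 2))) ?sqrtr_gt0//;
    last by move=> x; rewrite mule_ge0// lee_fin.
  rewrite muleA -ge0_integralZl//; last 3 first.
  - apply: emeasurable_funM.
      apply/measurable_EFinP; apply: (measurableT_comp (@normr_measurable _ _)).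
      exact: (@measurable_funM _ _ _ _ (cst _) id).
    under eq_fun do rewrite exprMn.
    exact: mh2.
  - by move=> x _; rewrite mule_ge0// lee_fin.
  - by rewrite lee_fin mulr_ge0 ?invr_ge0 ?sqrtr_ge0// ltW.
  apply: eq_integral => x _.
  rewrite muleA -EFinM exprMn sqr_sqrtr ?ltW// [x ^+ 2 * _]mulrC.
  congr (_%:E * _)%E.
  rewrite normrM (ger0_norm (sqrtr_ge0 _)) mulrA -[X in _ = X * _]mulrA.
  by rewrite -expr2 sqr_sqrtr ?ltW// mulVf ?mul1r// gt_eqF.
rewrite ge0_integralZr//.
- apply/measurable_EFinP; apply: continuous_measurable_fun.
  exact: continuous_oneDsqrV.
- by move=> t _; rewrite lee_fin invr_ge0 addr_ge0// sqr_ge0.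
- by apply: integral_ge0 => x _; rewrite mule_ge0// lee_fin.
Qed.

(** * Integrals of linear combinations of [2 x e^(- l x^2)] *)

Lemma is_derive_continuous (R : realType) (f : R -> R) (x df : R) :
  is_derive x 1 f df -> {for x, continuous f}.
Proof.
by case=> dfx _; apply: differentiable_continuous; apply/derivable1_diffP.
Qed.

(** The rates [l i] may have either sign: negative ones occur when the added weight exceeds an
    earlier one. *)
Lemma is_derive_sum_gauss (R : realType) (I : eqType) (s : seq I)
  (B l : I -> R) (x : R) : {in s, forall i, l i != 0} ->
  is_derive x 1 (fun y : R => - \sum_(i <- s) B i / l i * expR (- (l i * y ^+ 2)))
    (\sum_(i <- s) B i * (2 * x * expR (- (l i * x ^+ 2)))).
Proof.
elim: s => [|i s IH] l0.
  under eq_fun do rewrite big_nil oppr0.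
  by rewrite big_nil; exact: is_derive_cst.
under eq_fun do rewrite big_cons opprD.
have {IH} := IH (fun j js => l0 j (mem_behead (s := i :: s) js)).
rewrite big_cons => IH; apply: is_deriveD.
apply: is_derive_eq.
have := l0 i (mem_head _ _); rewrite !scaler1 /= /GRing.scale/= => li0; by field.
Qed.

Lemma cvg_sum_gauss (R : realType) (I : Type) (s : seq I) (B l : I -> R) :
  (forall i, 0 < l i) ->
  - \sum_(i <- s) B i / l i * expR (- (l i * y ^+ 2)) @[y --> +oo] --> (0 : R).
Proof.
move=> l0; rewrite -[X in _ --> X]oppr0; apply: cvgN; elim: s => [|i s IH].
  by rewrite (eq_cvg _ _ (fun=> big_nil _ _ _ _)); exact: cvg_cst.
rewrite (eq_cvg _ _ (fun=> big_cons _ _ _ _ _ _)).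
have cvgi : B i / l i * expR (- (l i * y ^+ 2)) @[y --> +oo] --> B i / l i * 0.
  apply: cvgMl_tmp; apply: (cvg_comp (fun y => l i * y ^+ 2) (fun y => expR (- y))).
    by apply: gt0_cvgMry => //; exact: cvgr_expr2.
  exact: cvgr_expR.
by have := cvgD cvgi IH; rewrite mulr0 addr0; apply. 
Qed.

Lemma continuous_sum_gauss (R : realType) (I : Type) (s : seq I) (B l : I -> R) :
  continuous (fun x : R => \sum_(i <- s) B i * (2 * x * expR (- (l i * x ^+ 2)))).
Proof.
elim: s => [|i s IH] x.
  rewrite (_ : (fun _ => _) = cst 0); first exact: cst_continuous.
  by apply/funext => y; rewrite big_nil.
rewrite (_ : (fun _ => _) = (fun y => B i * (2 * y * expR (- (l i * y ^+ 2)))) \+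
    (fun y => \sum_(j <- s) B j * (2 * y * expR (- (l j * y ^+ 2))))); last first.
  by apply/funext => y; rewrite big_cons.
apply: continuousD; last exact: IH.
apply: cvgMl_tmp; apply: cvgM; first exact: mulrl_continuous.
apply: continuous_comp; last exact: continuous_expR.
apply: cvgN; apply: cvgMl_tmp; exact: exprn_continuous.
Qed.

(** The fundamental theorem of calculus on a half-line asks for a nonnegative integrand. This is
    imposed on the whole sum because the coefficients produced by the Lagrange products can be
    negative. *)
Lemma integral_sum_gauss_tail (R : realType) (I : eqType) (s : seq I)
    (B l : I -> R) (a : R) : (forall i, 0 < l i) ->
  (forall x, a <= x ->
    0 <= \sum_(i <- s) B i * (2 * x * expR (- (l i * x ^+ 2)))) ->
  (\int[lebesgue_measure]_(x in `[a, +oo[)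
     (\sum_(i <- s) B i * (2 * x * expR (- (l i * x ^+ 2))))%:E =
   (\sum_(i <- s) B i / l i * expR (- (l i * a ^+ 2)))%:E)%E.
Proof.
move=> l0 f0.
have ln0 : {in s, forall i, l i != 0} by move=> i _; rewrite gt_eqF.
have dF x := is_derive_sum_gauss B x ln0.
rewrite (ge0_continuous_FTC2y f0 _ (cvg_sum_gauss s B l0)).
- by rewrite -EFinN opprK add0e.
- by apply: continuous_subspaceT; exact: continuous_sum_gauss.
- by move=> x _; have [] := dF x.
- by apply: cvg_at_right_filter; exact: (is_derive_continuous (dF a)).
- by move=> x _; rewrite derive1E; have [_ ->] := dF x.
Qed.

(** On a bounded interval negative rates cause no divergence; this serves the range of radii where
    the threshold is still nonnegative after a positive weight is added. *)
Lemma integral_sum_gauss_itv (R : realType) (I : eqType) (s : seq I)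
    (B l : I -> R) (a : R) : {in s, forall i, l i != 0} -> 0 <= a ->
  (\int[lebesgue_measure]_(x in `[0%R, a])
     (\sum_(i <- s) B i * (2 * x * expR (- (l i * x ^+ 2))))%:E =
   (\sum_(i <- s) B i / l i * (1 - expR (- (l i * a ^+ 2))))%:E)%E.
Proof.
move=> l0; rewrite le_eqVlt => /predU1P[<-|a0].
  rewrite set_itv1 integral_set1; under eq_bigr do
    rewrite expr0n mulr0 oppr0 expR0 subrr mulr0.
  by rewrite big1.
have dF x := is_derive_sum_gauss B x l0.
rewrite (continuous_FTC2 a0 _ (F := fun y =>
  - \sum_(i <- s) B i / l i * expR (- (l i * y ^+ 2)))).
- rewrite -EFinB; congr _%:E; rewrite opprK addrC -sumrB.
  apply: eq_bigr => i _; rewrite expr0n/= mulr0 oppr0 expR0.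
  by rewrite mulrBr.
- by apply: continuous_subspaceT; exact: continuous_sum_gauss.
- split.
  + by move=> x _; have [] := dF x.
  + by apply: cvg_at_right_filter; exact: (is_derive_continuous (dF 0)).
  + by apply: cvg_at_left_filter; exact: (is_derive_continuous (dF a)).
- by move=> x _; rewrite derive1E; have [_ ->] := dF x.
Qed.

(** * The law of [|h|^2] in polar form *)

Lemma normal_pdf_half (R : realType) (x : R) :
  normal_pdf 0 (Num.sqrt 2^-1) x =
  normal_peak (Num.sqrt 2^-1 : R) * expR (- x ^+ 2).
Proof.
rewrite normal_pdfE ?gt_eqF ?sqrtr_gt0//= /normal_fun subr0.
by rewrite sqr_sqrtr// (_ : 2^-1 *+ 2 = 1 :> R) ?divr1//; lra.
Qed.

Lemma ge0_integral_even (R : realType) (f : R -> \bar R) :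
  measurable_fun [set: R] f -> (forall x, 0 <= f x)%E ->
  (forall x, f (- x) = f x) ->
  (\int[lebesgue_measure]_x f x =
   \int[lebesgue_measure]_(x in `[0%R, +oo[) (2%:E * f x))%E.
Proof.
move=> mf f0 fN.
have -> : [set: R] = `]-oo, 0%R] `|` `]0%R, +oo[.
  by apply/seteqP; split => x //= _; rewrite !in_itv/= andbT; case: (leP x 0) => x0; [left|right].
rewrite ge0_integral_setU//=; last 2 first.
- exact: measurable_funTS.
- apply/disj_setPS => x [] /=; rewrite !in_itv/= andbT => x0.
  by rewrite ltNge x0.
rewrite integral_itv_obnd_cbnd; last exact: measurable_funTS.
rewrite [X in (_ + X)%E]ge0_integration_by_substitution0//.
under [X in (_ + X)%E]eq_integral do rewrite fN.
rewrite ge0_integralZl//; last exact: measurable_funTS.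
rewrite [in RHS]ge0_integration_by_substitution0//.
under [in RHS]eq_integral do rewrite fN.
by rewrite mule_natl mule2n.
Qed.

(** The product of two N(0, 1/2) densities depends only on [x^2 + y^2], so polar coordinates leave a
    radial integral; [2 x e^(-x^2)] is the Rayleigh density of [|h|]. *)
Lemma ge0_integral_normal_sqr_add (R : realType) (G : R -> \bar R) :
  measurable_fun [set: R] G -> (forall x, 0 <= G x)%E ->
  (\int[normal_prob 0 (Num.sqrt 2^-1)]_x
     \int[normal_prob 0 (Num.sqrt 2^-1)]_y G (x ^+ 2 + y ^+ 2)%R =
   \int[lebesgue_measure]_(x in `[0%R, +oo[)
     (G (x ^+ 2)%R * (2 * x * expR (- x ^+ 2))%:E))%E.
Proof.
pose K : R := normal_peak (Num.sqrt 2^-1).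
have K0 : 0 <= K by exact: normal_peak_ge0.
have msqr : measurable_fun [set: R] (fun x : R => x ^+ 2).
  exact: measurable_funX.
have mexp : measurable_fun [set: R] (fun x : R => expR (- x)).
  by apply: measurableT_comp => //; exact: measurableT_comp.
set C : \bar R := (\int[lebesgue_measure]_t ((1 + t ^+ 2)^-1)%:E)%E.
suff main (F : R -> \bar R) :
    measurable_fun [set: R] F -> (forall x, 0 <= F x)%E ->
    (\int[normal_prob 0 (Num.sqrt 2^-1)]_x
       \int[normal_prob 0 (Num.sqrt 2^-1)]_y F (x ^+ 2 + y ^+ 2)%R =
     C * ((K ^+ 2)%:E * \int[lebesgue_measure]_(x in `[0%R, +oo[)
     (F (x ^+ 2)%R * (2 * x * expR (- x ^+ 2))%:E)))%E.
  move=> mG G0; rewrite main// muleA.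
  (* The total mass of the normal laws fixes the constant. *)
  suff -> : (C * (K ^+ 2)%:E = 1)%E by rewrite mul1e.
  have := main (cst 1%E) (measurable_cst _) (fun=> lee01).
  have int1 : (\int[normal_prob 0 (Num.sqrt 2^-1 : R)]_x cst 1 x = 1)%E.
    by rewrite integral_cst// mul1e; exact: probability_setT.
  under eq_integral do rewrite int1.
  rewrite int1 => ->.
  rewrite [X in (_ * (_ * X))%E](_ : _ = 1%E) ?mule1//.
  have := @integral_sum_gauss_tail R unit [:: tt] (fun=> 1) (fun=> 1) 0.
  rewrite !big_seq1 expr0n mulr0 oppr0 expR0 !divr1 mul1r => E; rewrite -[RHS]E//.
    by apply: eq_integral => x _; rewrite big_seq1 /= !mul1r mul1e.
  by move=> x x0; rewrite big_seq1 mul1r mulr_ge0 ?expR_ge0// mulr_ge0.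
move=> mF F0.
(* The joint density is absorbed into [h], with one factor [K] from each normal law. *)
pose h v := (F v * (K ^+ 2 * expR (- v))%:E)%E.
have mh : measurable_fun [set: R] h.
  by apply: emeasurable_funM => //; apply/measurable_EFinP; exact: measurable_funM.
have h0 x : (0 <= h x)%E by rewrite mule_ge0// lee_fin mulr_ge0 ?expR_ge0 ?sqr_ge0.
have mF2 : measurable_fun [set: R * R] (fun z : R * R => F (z.1 ^+ 2 + z.2 ^+ 2)).
  apply: measurableT_comp => //; apply: measurable_funD;
    exact: measurableT_comp msqr _.
have mFx (x : R) : measurable_fun [set: R] (fun y : R => F (x ^+ 2 + y ^+ 2)).
  by apply: measurableT_comp => //; exact: measurable_funD.
have mpdf : measurable_fun [set: R]
    (fun x : R => (normal_pdf 0 (Num.sqrt 2^-1) x)%:E).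
  by apply/measurable_EFinP; exact: measurable_normal_pdf.
transitivity (\int[lebesgue_measure]_x \int[lebesgue_measure]_y
    h (x ^+ 2 + y ^+ 2)%R)%E.
  rewrite ge0_integral_normal//; last 2 first.
  - exact: (@measurable_fun_fubini_tonelli_F _ _ _ _ _ (normal_prob 0 (Num.sqrt 2^-1)) _ mF2).
  - by move=> x; exact: integral_ge0.
  apply: eq_integral => x _.
  rewrite ge0_integral_normal// -ge0_integralZr//; last 3 first.
  - exact: emeasurable_funM (mFx x) mpdf.
  - by move=> y _; rewrite mule_ge0// lee_fin normal_pdf_ge0.
  - by rewrite lee_fin normal_pdf_ge0.
  apply: eq_integral => y _; rewrite -muleA -EFinM !normal_pdf_half -/K.
  by congr (_ * _%:E)%E; rewrite opprD expRD; ring.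
rewrite ge0_integral_sqr_add//; congr (_ * _)%E.
(* Folding the even integrand onto the half-line produces the factor 2 of the Rayleigh density. *)
rewrite ge0_integral_even; last 3 first.
- apply: emeasurable_funM; last exact: measurableT_comp.
  by apply/measurable_EFinP => /=; apply: normr_measurable.
- by move=> x; rewrite mule_ge0// lee_fin.
- by move=> x; rewrite normrN sqrrN.
rewrite -ge0_integralZl//; last 3 first.
- apply: emeasurable_funM; first exact: measurable_funTS (measurableT_comp mF msqr).
  apply/measurable_EFinP; apply: measurable_funTS; apply: measurable_funM.
    exact: measurable_funM.
  exact: measurableT_comp mexp msqr.
- move=> x /=; rewrite in_itv/= andbT => x0.
  by rewrite mule_ge0// lee_fin mulr_ge0 ?expR_ge0// mulr_ge0.
- by rewrite lee_fin sqr_ge0.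
apply: eq_integral => x; rewrite inE/= in_itv/= andbT => x0.
rewrite /h ger0_norm// muleCA [in RHS]muleCA muleA [in LHS]muleCA.
by rewrite -!EFinM; congr (_ * _%:E)%E; ring.
Qed.

(** * Independence and the addition of one real variable *)

(** [A] collects the indices already used to build [S]. Taking [B i = setT] there leaves an event
    about the remaining variables only, while the intersection keeps the shape of
    [mutually_independent_RV]. *)
Definition independent_outside {d} {T : measurableType d} {R : realType}
    (P : probability T R) (I : finType) (X : I -> {RV P >-> R}) (A : {set I})
    (S : T -> R) : Prop :=
  forall (U : set R) (B : I -> set R), measurable U ->
    (forall i, measurable (B i)) -> (forall i, i \in A -> B i = setT) ->
    (P (S @^-1` U `&` \bigcap_(i in [set: I]) (X i @^-1` B i)) =
     P (S @^-1` U) * P (\bigcap_(i in [set: I]) (X i @^-1` B i)))%E.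

Lemma independent_outside_cst d (T : measurableType d) (R : realType)
    (P : probability T R) (I : finType) (X : I -> {RV P >-> R}) (a : R) :
  independent_outside X finset.set0 (cst a).
Proof.
move=> U B mU mB _; rewrite preimage_cst; case: ifPn => _.
  by rewrite setTI probability_setT mul1e.
by rewrite set0I measure0 mul0e.
Qed.

Lemma measurable_probability_section d (T : measurableType d) (R : realType)
    (P : probability T R) (S : T -> R) (g : R * R -> R) (U : set R) :
  measurable_fun [set: T] S -> measurable_fun [set: R * R] g -> measurable U ->
  measurable_fun [set: R] (fun y => P (S @^-1` [set s | U (g (s, y))])).
Proof.
move=> mS mg mU.
pose S' : {mfun T >-> R} := HB.pack S (isMeasurableFun.Build _ _ _ _ S mS).
rewrite (_ : (fun _ => _) = distribution P S' \o ysection (g @^-1` U)).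
  apply: measurable_fun_ysection.
  by rewrite -[X in measurable X]setTI; exact: mg.
apply/funext => y; congr (P (S @^-1` _)).
by apply/seteqP; split => s /=; rewrite /ysection/= inE.
Qed.

Section add_variable.
Context d (T : measurableType d) (R : realType) (P : probability T R).
Context (I : finType) (X : I -> {RV P >-> R}).
Hypothesis indX : mutually_independent_RV X.
Variables (A : {set I}) (S : T -> R) (i : I).
Hypotheses (mS : measurable_fun [set: T] S) (indS : independent_outside X A S).
Hypothesis iA : i \notin A.

Let C (B : I -> set R) := \bigcap_(i in [set: I]) (X i @^-1` B i).

Let mC B : (forall j, measurable (B j)) -> measurable (C B).
Proof.
move=> mB; apply: fin_bigcap_measurable; first exact: finite_finset.
by move=> j _; rewrite -[_ @^-1` _]setTI; exact: measurable_funP.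
Qed.

Let lawS : probability R R.
Proof.
pose S' : {mfun T >-> R} := HB.pack S (isMeasurableFun.Build _ _ _ _ S mS).
exact: (distribution P S').
Defined.

(** Once restricted to [C B], the law of [(S, X i)] is a finite measure agreeing on rectangles with
    [P (C B)] times the product of the marginal laws; uniqueness of product measures extends this to
    every [W]. *)
Let joint (W : set (R * R)) (B : I -> set R) : measurable W ->
  (forall j, measurable (B j)) -> (forall j, j \in i |: A -> B j = setT) ->
  (P ((fun w => (S w, X i w)) @^-1` W `&` C B) =
   (lawS \x distribution P (X i)) W * P (C B))%E.
Proof.
move=> mW mB BT.
have mSX : measurable_fun [set: T] (fun w => (S w, X i w)).
  exact: measurable_fun_pair.
have [k Pk] : exists k : {nonneg R}, P (C B) = k%:num%:E.
  exists (NngNum (fine_ge0 (measure_ge0 P (C B)))).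
  by rewrite /= fineK// fin_num_measure//; exact: mC.
(* The constant [P (C B)] is attached to the first factor, so that the right-hand side is itself a
   product measure. *)
pose m1 : {finite_measure set R -> \bar R} := mscale k lawS.
have @m : {measure set (R * R) -> \bar R}.
  refine (pushforward (mrestr P (mC mB)) (fun w => (S w, X i w))).
  exact: mSX.
rewrite Pk muleC -[RHS]/(k%:num%:E * _)%E.
rewrite [LHS](_ : _ = m W)// -(@product_measure_unique _ _ _ _ _ m1
  (distribution P (X i)) m)//; last first.
  (* The condition [X i \in V] is stored in the slot [i] of [B], free because [B i = setT]; as
     [i \notin A], the family [B'] is still [setT] on [A]. *)
  move=> U V mU mV; pose B' j := if j == i then V else B j.
  have mB' j : measurable (B' j) by rewrite /B'; case: ifP.
  have CB' : C B' = X i @^-1` V `&` C B.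
    apply/seteqP; split => w.
      move=> CB'w; split; first by have := CB'w i Logic.I; rewrite /B' eqxx.
      move=> j _; have [->|ji] := eqVneq j i; first by rewrite BT ?setU11.
      by have := CB'w j Logic.I; rewrite /B' (negbTE ji).
    case=> Vw CBw j _; rewrite /B'.
    by case: eqVneq => [->//|_]; exact: CBw.
  have PCB' : (P (C B') = P (X i @^-1` V) * P (C B))%E.
    rewrite !indX// (bigD1 i)//= [in RHS](bigD1 i)//= /B' eqxx.
    rewrite (BT i) ?setU11// preimage_setT probability_setT mul1e.
    by congr (_ * _)%E; apply: eq_bigr => j /negbTE ->.
  rewrite -[LHS]/(P (_ `&` _)) (_ : _ `&` _ = S @^-1` U `&` C B').
    rewrite indS//; last first.
      move=> j jA; rewrite /B'; case: eqVneq => [ji|_].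
        by have := iA; rewrite -ji jA.
      by rewrite BT// setU1r.
    by rewrite -/(C B') PCB' Pk muleA muleC muleA.
  by rewrite CB' setIA; congr (_ `&` _).
rewrite /product_measure1 ge0_integral_mscale//.
exact: measurable_fun_xsection.
Qed.

Let joint_law (W : set (R * R)) : measurable W ->
  P ((fun w => (S w, X i w)) @^-1` W) = (lawS \x distribution P (X i))%E W.
Proof.
move=> mW; have := @joint W (fun=> setT) mW (fun=> measurableT) (fun _ _ => erefl).
have -> : C (fun=> setT) = setT by apply/seteqP; split.
by rewrite setIT probability_setT mule1.
Qed.

Variable g : R * R -> R.
Hypothesis mg : measurable_fun [set: R * R] g.

Let mgU U : measurable U -> measurable (g @^-1` U).
Proof. by move=> mU; rewrite -[_ @^-1` _]setTI; exact: mg. Qed.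

Lemma independent_outside_setU1 :
  independent_outside X (i |: A) (fun w => g (S w, X i w)).
Proof.
move=> U B mU mB BT; have := joint (mgU mU) mB BT.
by rewrite -joint_law//; exact: mgU.
Qed.

(** The joint law is a product, and slicing it along the second coordinate conditions on the value
    [y] of [X i]. *)
Lemma probability_add_variable U : measurable U ->
  (P ((fun w => g (S w, X i w)) @^-1` U) =
   \int[distribution P (X i)]_y P (S @^-1` [set s | U (g (s, y))]))%E.
Proof.
move=> mU; rewrite -[LHS]/(P ((fun w => (S w, X i w)) @^-1` (g @^-1` U))).
rewrite joint_law; last exact: mgU.
transitivity ((lawS \x^ distribution P (X i))%E (g @^-1` U)).
  apply: product_measure_unique => [V W mV mW|]; last exact: mgU.
  exact: product_measure2E.
rewrite /product_measure2; apply: eq_integral => y _; congr (P (S @^-1` _)).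
by apply/seteqP; split => s /=; rewrite /ysection/= inE.
Qed.

End add_variable.

(** * Adding one weighted squared modulus *)

Lemma measurable_abs2_h d (T : measurableType d) (R : realType)
    (P : probability T R) (K : finType) (X : (K * bool)%type -> {RV P >-> R})
    (k : K) :
  measurable_fun [set: T] (abs2_h X k).
Proof. by apply: measurable_funD; apply: measurable_funX. Qed.

Section add_abs2_h.
Context d (T : measurableType d) (R : realType) (P : probability T R).
Context (K : finType) (X : (K * bool)%type -> {RV P >-> R}).
Hypothesis indX : mutually_independent_RV X.
Hypothesis lawX : forall i, has_normal_law (X i) 0 (Num.sqrt (2^-1)).
Variables (A : {set K}) (S : T -> R) (k : K) (a : R).
Let A2 := [set i : K * bool | i.1 \in A]%SET.
Hypotheses (mS : measurable_fun [set: T] S) (indS : independent_outside X A2 S).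
Hypothesis kA : k \notin A.

(** The two real coordinates of [h_k] are added separately; this is the sum after the real part. *)
Let S1 w := S w + a * X (k, true) w ^+ 2.

Let mS1 : measurable_fun [set: T] S1.
Proof.
apply: measurable_funD => //; apply: measurable_funM => //.
exact: measurable_funX.
Qed.

Let g (z : R * R) : R := z.1 + a * z.2 ^+ 2.

Let mg : measurable_fun [set: R * R] g.
Proof.
apply: measurable_funD => //; apply: measurable_funM => //.
exact: measurable_funX.
Qed.

Let ktA : (k, true) \notin A2. Proof. by rewrite inE. Qed.

Let kfA : (k, false) \notin ((k, true) |: A2).
Proof. by rewrite !inE/= xpair_eqE andbF. Qed.

Let indS1 : independent_outside X ((k, true) |: A2) S1.
Proof. exact: (independent_outside_setU1 indX mS indS ktA mg). Qed.

Let addE : (fun w => S w + a * abs2_h X k w) =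
  (fun w => g (S1 w, X (k, false) w)).
Proof. by apply/funext => w; rewrite /g/= /S1 /abs2_h mulrDr addrA. Qed.

Lemma independent_outside_add_abs2_h :
  independent_outside X [set i : K * bool | i.1 \in k |: A]%SET
    (fun w => S w + a * abs2_h X k w).
Proof.
rewrite addE (_ : [set i | _]%SET = (k, false) |: ((k, true) |: A2)).
  exact: (independent_outside_setU1 indX mS1 indS1 kfA mg).
by apply/setP => -[j b]; rewrite !inE/= !xpair_eqE; case: b;
  rewrite ?andbT ?andbF ?orbF.
Qed.

(** Conditioning on the imaginary part, then on the real part, gives a double normal integral of a
    function of [x^2 + y^2], to which the polar formula applies. *)
Lemma tail_add_abs2_h c :
  (P [set w | c < S w + a * abs2_h X k w]%R =
   \int[lebesgue_measure]_(x in `[0%R, +oo[)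
     (P [set w | c - a * x ^+ 2 < S w]%R * (2 * x * expR (- x ^+ 2))%:E))%E.
Proof.
pose G (v : R) : \bar R := P [set w | c - a * v < S w].
have lawE (i : (K * bool)%type) (f : R -> \bar R) :
    measurable_fun [set: R] f -> (forall x, 0 <= f x)%E ->
    (\int[distribution P (X i)]_x f x =
     \int[normal_prob 0 (Num.sqrt 2^-1)]_x f x)%E.
  (* [normal_prob] is a measure on [measurableTypeR R], whose display is not that
     of [R]: transport it along the identity. *)
  move=> mf f0; have @m : {measure set R -> \bar R}.
    refine (pushforward (normal_prob 0 (Num.sqrt 2^-1))
      (id : measurableTypeR R -> R)).
    exact: measurable_id.
  transitivity (\int[m]_x f x)%E; last by rewrite ge0_integral_pushforward.
  by apply: eq_measure_integral => B mB _; exact: lawX.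
have mtl (r : R) : measurable [set s | r < s].
  by rewrite -set_itvoy.
rewrite -[LHS]/(P ((fun w => S w + a * abs2_h X k w) @^-1` [set s | c < s])).
rewrite addE (probability_add_variable indX mS1 indS1 kfA mg)// lawE//;
  last exact: measurable_probability_section.
have mG : measurable_fun [set: R] G.
  rewrite (_ : G = fun v => P (S @^-1` [set s | c < s + a * v])).
    apply: (@measurable_probability_section _ _ _ _ _ (fun z => z.1 + a * z.2)
      [set s | c < s]) => //.
    by apply: measurable_funD => //; exact: measurable_funM.
  by apply/funext => v; congr (P _); apply/seteqP; split => w /=; rewrite ltrBlDr.
apply: etrans (ge0_integral_normal_sqr_add mG (fun=> measure_ge0 _ _)).
apply: eq_integral => x _.
have -> : S1 @^-1` [set s | [set t | c < t] (g (s, x))] =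
    S1 @^-1` [set s | c - a * x ^+ 2 < s].
  by apply/seteqP; split => s; rewrite /g/= ltrBlDr.
rewrite (probability_add_variable indX mS indS ktA mg)// lawE//;
  last exact: measurable_probability_section.
apply: eq_integral => y _; congr (P _).
by apply/seteqP; split => w; rewrite /g/= ltrBlDr mulrDr => h; lra.
Qed.

End add_abs2_h.

(** * Lagrange interpolation of a constant *)

Lemma size_prod_seq_linear (F : fieldType) (I : Type) (s : seq I) (p : pred I)
    (f : I -> {poly F}) : (forall i, (size (f i) <= 2)%N) ->
  (size (\prod_(i <- s | p i) f i)%R <= (count p s).+1)%N.
Proof.
move=> f2; elim: s => [|i s IH]; first by rewrite big_nil size_poly1.
rewrite big_cons /=; case: (p i) => //=; rewrite add1n.
apply: leq_trans (size_polyMleq _ _) _.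
by rewrite -subn1 leq_subLR; exact: leq_add (f2 i) IH.
Qed.

(* Lagrange interpolation of the constant 1 at the nodes [1 / p j], evaluated
   at 0. *)
Lemma sum_prod_div_sub (F : fieldType) (I : eqType) (s : seq I) (p : I -> F) :
  uniq s -> s != [::] -> {in s &, injective p} -> (forall i, p i != 0) ->
  \sum_(n <- s) \prod_(j <- s | j != n) (p n / (p n - p j)) = 1.
Proof.
move=> us s0 pinj p0.
pose L n : {poly F} :=
  \prod_(j <- s | j != n) (p n / (p n - p j) *: (1 - p j *: 'X)).
have Lx n x : (L n).[x] =
    \prod_(j <- s | j != n) (p n / (p n - p j) * (1 - p j * x)).
  rewrite horner_prod; apply: eq_bigr => j _.
  by rewrite !hornerE.
have size_L n : n \in s -> (size (L n) <= size s)%N.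
  move=> ns; rewrite -(count_predC (pred1 n)) count_uniq_mem// ns add1n.
  apply: size_prod_seq_linear => j; apply: leq_trans (size_scale_leq _ _) _.
  apply: leq_trans (size_polyD _ _) _; rewrite geq_max size_poly1/= size_polyN.
  by apply: leq_trans (size_scale_leq _ _) _; rewrite size_polyX.
(* [L n] is 1 at [1 / p n] and 0 at the other nodes, so [Q] vanishes at [size s] distinct points;
   its degree being less than [size s], it is zero. *)
pose Q := \sum_(n <- s) L n - 1.
suff Q0 : Q = 0.
  have : Q.[0] = 0 by rewrite Q0 horner0.
  rewrite !hornerE horner_sum => /eqP; rewrite subr_eq0 => /eqP Q1; rewrite -[RHS]Q1.
  apply: eq_bigr => n _; rewrite Lx; apply: eq_bigr => j _.
  by rewrite mulr0 subr0 mulr1.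
apply: (@roots_geq_poly_eq0 _ _ [seq (p n)^-1 | n <- s]).
- apply/allP => _ /mapP[m ms ->]; rewrite /root !hornerE horner_sum.
  rewrite (bigD1_seq m)//= big1_seq ?addr0 => [|n /andP[nm ns]]; last first.
    rewrite Lx; apply/eqP; rewrite prodf_seq_eq0; apply/hasP; exists m => //.
    by rewrite eq_sym nm divff// subrr mulr0 eqxx.
  rewrite Lx big1_seq ?subrr// => j /andP[jm js].
  have pmj : p m - p j != 0.
    by rewrite subr_eq0; apply: contra_neq jm => pmj; exact/esym/pinj.
  by have pm0 := p0 m; field; apply/andP.
- by rewrite map_inj_in_uniq// => m n ms ns /invr_inj; exact: pinj.
- rewrite size_map; apply: leq_trans (size_polyD _ _) _.
  rewrite size_polyN size_poly1 geq_max lt0n size_eq0 s0 andbT.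
  rewrite big_seq; apply: (big_ind (fun q : {poly F} => size q <= size s)%N).
  + by rewrite size_poly0.
  + by move=> q r qs rs; rewrite (leq_trans (size_polyD _ _))// geq_max qs.
  + by move=> n ns; exact: size_L.
Qed.

(** * Effect of one new weight on the tail *)

Section tail_recursion.
Context d (T : measurableType d) (R : realType) (P : probability T R).
Context (K : finType) (X : (K * bool)%type -> {RV P >-> R}).
Hypothesis indX : mutually_independent_RV X.
Hypothesis lawX : forall i, has_normal_law (X i) 0 (Num.sqrt (2^-1)).
Variables (A : {set K}) (S : T -> R) (k : K).
Hypothesis mS : measurable_fun [set: T] S.
Hypothesis indS : independent_outside X [set i : K * bool | i.1 \in A]%SET S.
Hypothesis kA : k \notin A.
Variables (I : eqType) (s : seq I) (B p : I -> R).
Hypothesis p_gt0 : forall i, 0 < p i.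

(** The shifted threshold [c + b x^2] stays nonnegative, so the exponential form of the tail holds
    for every radius; each term then integrates to [1 / l n = p n / (b + p n)]. *)
Lemma tail_sub_abs2_h (b c : R) : 0 <= b ->
  (forall t, 0 <= t ->
    P [set w | t < S w] = (\sum_(n <- s) B n * expR (- (t / p n)))%:E) ->
  0 <= c ->
  P [set w | c < S w + (- b) * abs2_h X k w] =
  (\sum_(n <- s) B n * (p n / (b + p n)) * expR (- (c / p n)))%:E.
Proof.
move=> b0 PS c0; rewrite (tail_add_abs2_h indX lawX _ mS indS kA).
(* Total rate in [x^2]: 1 from the Rayleigh density, [b / p n] from the shifted threshold. *)
pose l n := 1 + b / p n.
have l0 n : 0 < l n by rewrite ltr_pwDl// divr_ge0// ltW.
pose f x :=
  \sum_(n <- s) (B n * expR (- (c / p n))) * (2 * x * expR (- (l n * x ^+ 2))).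
have fE x : (P [set w | c - (- b) * x ^+ 2 < S w]%R *
    (2 * x * expR (- x ^+ 2))%:E = (f x)%:E)%E.
  rewrite PS; last by rewrite mulNr opprK addr_ge0// mulr_ge0// sqr_ge0.
  rewrite -EFinM mulr_suml; congr _%:E; apply: eq_bigr => n _.
  have pn0 : p n != 0 by rewrite gt_eqF.
  rewrite -!mulrA; congr (_ * _); rewrite mulrCA [RHS]mulrCA; congr (_ * _).
  rewrite mulrCA [RHS]mulrCA; congr (_ * _); rewrite -!expRD; congr expR.
  by rewrite /l; field.
transitivity (\int[lebesgue_measure]_(x in `[0%R, +oo[) (f x)%:E)%E.
  by apply: eq_integral => x _; exact: fE.
rewrite integral_sum_gauss_tail//.
  congr _%:E; apply: eq_bigr => n _.
  rewrite expr0n mulr0 oppr0 expR0 mulr1 mulrAC; congr (_ * _); congr (_ * _).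
  have pn0 : p n != 0 by rewrite gt_eqF.
  have pb0 : b + p n != 0 by rewrite gt_eqF// ltr_wpDl.
  by rewrite /l; field; rewrite pb0.
(* Nonnegativity is read off from the probabilistic form of [f], since single terms may be
   negative. *)
move=> x x0; rewrite -/(f x) -lee_fin -fE mule_ge0// lee_fin.
by rewrite mulr_ge0 ?expR_ge0// mulr_ge0.
Qed.

(** The radial integral is cut where the threshold [c - a x^2] changes sign: beyond that point the
    old tail is 1, before it the exponential form applies. The first range only contributes to
    [e^(- c / a)]. *)
Lemma tail_add_distinct_abs2_h (a : R) : 0 < a ->
  {in s, forall n, p n != a} ->
  (forall t, P [set w | t < S w] =
    (if t < 0 then 1 else \sum_(n <- s) B n * expR (- (t / p n)))%:E) ->
  forall c, P [set w | c < S w + a * abs2_h X k w] =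
  (if c < 0 then 1 else
   \sum_(n <- s) B n * (p n / (p n - a)) * expR (- (c / p n)) +
   (1 - \sum_(n <- s) B n * (p n / (p n - a))) * expR (- (c / a)))%:E.
Proof.
move=> a0 pa PS c; rewrite (tail_add_abs2_h indX lawX _ mS indS kA).
have int1 (r : R) : 0 <= r ->
    (\int[lebesgue_measure]_(x in `[r, +oo[) (2 * x * expR (- x ^+ 2))%:E =
    (expR (- r ^+ 2))%:E)%E.
  move=> r0; have := @integral_sum_gauss_tail R unit [:: tt] (cst 1) (cst 1) r.
  rewrite !big_seq1 /= divr1 !mul1r => E; rewrite -[RHS]E//.
    by apply: eq_integral => x _; rewrite big_seq1 /= !mul1r.
  move=> x rx; rewrite big_seq1 /= mul1r.
  by rewrite mulr_ge0 ?expR_ge0// mulr_ge0// (le_trans r0).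
have [c0|c0] := ltP c 0.
  transitivity (\int[lebesgue_measure]_(x in `[0%R : R, +oo[)
      (2 * x * expR (- x ^+ 2))%:E)%E.
    apply: eq_integral => x _; rewrite PS ifT ?mul1e//.
    by rewrite subr_lt0 (lt_le_trans c0)// mulr_ge0 ?sqr_ge0// ltW.
  by rewrite int1// expr0n oppr0 expR0.
(* The radius at which [c - a x^2] vanishes. *)
pose r := Num.sqrt (c / a).
have r2 : r ^+ 2 = c / a by rewrite sqr_sqrtr// divr_ge0// ltW.
have r0 : 0 <= r by exact: sqrtr_ge0.
have PS1 x : r < x -> P [set w | c - a * x ^+ 2 < S w] = 1%E.
  move=> rx; rewrite PS ifT// subr_lt0 mulrC -ltr_pdivrMr// -r2.
  by rewrite ltr_pXn2r// nnegrE// ltW// (le_lt_trans r0).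
(* The rate is negative when [p n < a], and nonzero on [s] because [p n != a]. *)
pose l n := if n \in s then 1 - a / p n else 1.
have p0 n : p n != 0 by rewrite gt_eqF.
have pa0 n : n \in s -> p n - a != 0 by move=> ns; rewrite subr_eq0 pa.
have l0 : {in s, forall n, l n != 0}.
  move=> n ns; rewrite /l ns -(divff (p0 n)) -mulrBl mulf_neq0 ?invr_eq0//.
  exact: pa0.
have PS2 x : 0 <= x <= r ->
    (P [set w | c - a * x ^+ 2 < S w]%R * (2 * x * expR (- x ^+ 2))%:E =
    (\sum_(n <- s) (B n * expR (- (c / p n))) *
      (2 * x * expR (- (l n * x ^+ 2))))%:E)%E.
  move=> /andP[x0 xr]; rewrite PS ifF; last first.
    apply/negbTE; rewrite -leNgt subr_ge0 mulrC -ler_pdivlMr// -r2.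
    by rewrite ler_pXn2r// nnegrE.
  rewrite -EFinM mulr_suml; congr _%:E; apply: eq_big_seq => n ns.
  rewrite -!mulrA; congr (_ * _); rewrite mulrCA [RHS]mulrCA; congr (_ * _).
  rewrite mulrCA [RHS]mulrCA; congr (_ * _); rewrite -!expRD; congr expR.
  by rewrite /l ns; field.
have mx : measurable_fun [set: R] (fun x : R => 2 * x * expR (- x ^+ 2)).
  by apply: measurable_funM; [exact: measurable_funM|exact: measurable_gauss_fun].
have mPS : measurable_fun [set: R]
    (fun x => P [set w | c - a * x ^+ 2 < S w]%R * (2 * x * expR (- x ^+ 2))%:E)%E.
  apply: emeasurable_funM.
    rewrite (_ : (fun _ => _) =
        fun x => P (S @^-1` [set t | c < t + a * x ^+ 2])).
      apply: (@measurable_probability_section _ _ _ _ _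
        (fun z => z.1 + a * z.2 ^+ 2) [set t | c < t]) => //.
        apply: measurable_funD => //; apply: measurable_funM => //.
        exact: measurable_funX.
      by rewrite -set_itvoy.
    by apply/funext => x; congr (P _); apply/seteqP; split => w /=;
      rewrite ltrBlDr.
  exact/measurable_EFinP.
have -> : `[0, +oo[%classic = `[0, r] `|` `]r, +oo[.
  apply/seteqP; split => x /=; rewrite !in_itv/= ?andbT.
    by move=> x0; case: (leP x r) => xr; [left; rewrite x0|right].
  by case=> [/andP[]//|rx]; rewrite (le_trans r0)// ltW.
rewrite ge0_integral_setU//=; last 3 first.
- exact: measurable_funTS.
- move=> x xs; rewrite mule_ge0// lee_fin mulr_ge0 ?expR_ge0// mulr_ge0//.
  by case: xs => /=; rewrite in_itv/= => /andP[x0 _] //; rewrite ltW// (le_lt_trans r0).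
- apply/disj_setPS => x [] /=; rewrite !in_itv/= andbT => /andP[_ xr].
  by rewrite ltNge xr.
transitivity (\int[lebesgue_measure]_(x in `[0%R, r])
    (\sum_(n <- s) (B n * expR (- (c / p n))) *
      (2 * x * expR (- (l n * x ^+ 2))))%:E +
  \int[lebesgue_measure]_(x in `]r, +oo[) (2 * x * expR (- x ^+ 2))%:E)%E.
  congr (_ + _)%E; apply: eq_integral => x; rewrite inE/= in_itv/= => xr.
    exact: PS2.
  by rewrite PS1 ?mul1e//; case/andP: xr.
rewrite integral_sum_gauss_itv// integral_itv_obnd_cbnd; last first.
  exact/measurable_EFinP/measurable_funTS.
rewrite int1// r2 -EFinD; congr _%:E.
(* Since [e^(- c / p n) e^(- l n r^2) = e^(- c / a)], the term [n] on [[0, r]] is [B n / l n * (e^(-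
   c / p n) - e^(- c / a))], where [1 / l n = p n / (p n - a)]. *)
rewrite mulrBl mul1r addrCA [LHS]addrC; congr (_ + _); rewrite mulr_suml -sumrB.
apply: eq_big_seq => n ns.
have -> : expR (- (l n * (c / a))) = expR (c / p n) * expR (- (c / a)).
  rewrite -expRD; congr expR; rewrite /l ns; field.
  by rewrite p0 gt_eqF.
rewrite expRN.
have e0 : expR (c / p n) != 0 by rewrite gt_eqF// expR_gt0.
have := pa0 n ns; have := p0 n; rewrite /l ns.
set e := expR (c / p n); set e' := expR _ => pn0 pna0.
by field; rewrite e0 pna0 pn0.
Qed.

End tail_recursion.

(** * Iteration over the cooperating and the interfering stations *)

Section weighted_sums.
Context d (T : measurableType d) (R : realType) (P : probability T R).
Context (K : finType) (X : (K * bool)%type -> {RV P >-> R}).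
Hypothesis indX : mutually_independent_RV X.
Hypothesis lawX : forall i, has_normal_law (X i) 0 (Num.sqrt (2^-1)).
Variable Pw : K -> R.
Hypothesis Pw_gt0 : forall n, 0 < Pw n.

(** Measurability and independence are carried along with the tail because the next variable can be
    added only under both. The empty sum is the constant 0, with tail 1 below 0 and 0 from 0 on. *)
Lemma tail_sum_abs2_h (s : seq K) : uniq s -> {in s &, injective Pw} ->
  [/\ measurable_fun [set: T] (fun w => \sum_(n <- s) Pw n * abs2_h X n w),
      independent_outside X [set i : K * bool | i.1 \in [set j in s]]%SET
        (fun w => \sum_(n <- s) Pw n * abs2_h X n w) &
      forall t, P [set w | t < \sum_(n <- s) Pw n * abs2_h X n w] =
        (if t < 0 then 1 else \sum_(n <- s)
           \prod_(j <- s | j != n) (Pw n / (Pw n - Pw j)) *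
           expR (- (t / Pw n)))%:E].
Proof.
elim: s => [_ _ /=|k s IH /= /andP[ks us] sinj].
  rewrite (_ : (fun w => \sum_(n <- [::]) _) = cst 0); last first.
    by apply/funext => w; rewrite big_nil.
  split; first exact: measurable_cst.
    have -> : [set i : K * bool | i.1 \in [set j in [::]]]%SET = finset.set0.
      by apply/setP => i; rewrite !inE.
    exact: independent_outside_cst.
  move=> t; rewrite big_nil; case: ifPn => t0.
    rewrite (_ : [set w | _] = setT) ?probability_setT//.
    by apply/seteqP; split => // w _ /=; rewrite big_nil.
  rewrite (_ : [set w | _] = set0) ?measure0//.
  by apply/seteqP; split => // w /=; rewrite big_nil (negbTE t0).
have [|mS indS tailS] := IH us.
  by move=> i j si sj; apply: sinj; rewrite inE ?si ?sj orbT.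
rewrite (_ : (fun w => \sum_(n <- k :: s) _) =
    (fun w => \sum_(n <- s) Pw n * abs2_h X n w + Pw k * abs2_h X k w)); last first.
  by apply/funext => w; rewrite big_cons addrC.
have kA : k \notin [set j in s] by rewrite inE.
have nk : {in s, forall n, k != n}.
  by move=> n ns; apply: contraNneq ks => ->.
have nPk : {in s, forall n, Pw n != Pw k}.
  move=> n ns; apply: contraNneq (nk _ ns) => /sinj ->//; first by rewrite inE ns orbT.
  exact: mem_head.
split.
- apply: measurable_funD => //; apply: measurable_funM => //.
  exact: measurable_abs2_h.
- rewrite finset.set_cons.
  exact: (independent_outside_add_abs2_h indX _ mS indS kA).
move=> t.
have -> : [set w | t < \sum_(n <- k :: s) Pw n * abs2_h X n w] =
    [set w | t < \sum_(n <- s) Pw n * abs2_h X n w + Pw k * abs2_h X k w].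
  by apply/funext => w; rewrite /= big_cons addrC.
rewrite (tail_add_distinct_abs2_h indX lawX mS indS kA Pw_gt0
  (Pw_gt0 k) nPk tailS).
case: ifPn => // _; congr _%:E; rewrite big_cons addrC.
have coefE : {in s, forall n, \prod_(j <- k :: s | j != n) (Pw n / (Pw n - Pw j)) =
    \prod_(j <- s | j != n) (Pw n / (Pw n - Pw j)) * (Pw n / (Pw n - Pw k))}.
  by move=> n ns; rewrite big_cons nk// mulrC.
congr (_ * _ + _); last by apply: eq_big_seq => n ns; rewrite coefE.
have Pw0 n : Pw n != 0 by rewrite gt_eqF.
(* The Lagrange coefficients over [k :: s] add up to 1, so the remainder left by those of [s] is
   exactly the coefficient of [k]. *)
have := @sum_prod_div_sub _ _ (k :: s) Pw _ isT sinj Pw0.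
rewrite /= ks us => /(_ isT); rewrite big_cons => Q.
rewrite -[X in X - _]Q (_ : \sum_(n <- s) _ = \sum_(n <- s)
  \prod_(j <- s | j != n) (Pw n / (Pw n - Pw j)) * (Pw n / (Pw n - Pw k))).
  by rewrite addrK.
by apply: eq_big_seq => n ns; rewrite coefE.
Qed.

(** Each subtraction only raises the threshold, so the class of tails known for [c >= 0] is stable,
    and each interferer multiplies the coefficient of [n] by one factor. *)
Lemma tail_sub_sum_abs2_h (A : {set K}) (S : T -> R) (s t : seq K)
    (B b : K -> R) :
  measurable_fun [set: T] S ->
  independent_outside X [set i : K * bool | i.1 \in A]%SET S ->
  (forall c, 0 <= c ->
    P [set w | c < S w] = (\sum_(n <- s) B n * expR (- (c / Pw n)))%:E) ->
  (forall k, 0 <= b k) -> uniq t -> {in t, forall k, k \notin A} ->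
  [/\ measurable_fun [set: T] (fun w => S w - \sum_(k <- t) b k * abs2_h X k w),
      independent_outside X
        [set i : K * bool | i.1 \in [set j in t] :|: A]%SET
        (fun w => S w - \sum_(k <- t) b k * abs2_h X k w) &
      forall c, 0 <= c ->
        P [set w | c < S w - \sum_(k <- t) b k * abs2_h X k w] =
        (\sum_(n <- s) B n * \prod_(k <- t) (Pw n / (b k + Pw n)) *
           expR (- (c / Pw n)))%:E].
Proof.
move=> mS indS tailS b0; elim: t => [_ _ /=|k t IH /= /andP[kt ut] tA].
  rewrite (_ : (fun w => S w - _) = S); last first.
    by apply/funext => w; rewrite big_nil subr0.
  split => //.
    rewrite (_ : [set i | _]%SET = [set i : K * bool | i.1 \in A]%SET)//.
    by apply/setP => i; rewrite !inE.
  move=> c c0; have -> : [set w | c < S w - \sum_(k <- [::]) b k * abs2_h X k w] =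
      [set w | c < S w].
    by apply/funext => w; rewrite /= big_nil subr0.
  by rewrite tailS//; congr _%:E; apply: eq_bigr => n _;
    rewrite big_nil mulr1.
have [//||mS' indS' tailS'] := IH.
  by move=> i it; apply: tA; rewrite inE it orbT.
rewrite (_ : (fun w => S w - _) = (fun w =>
    (S w - \sum_(k <- t) b k * abs2_h X k w) + (- b k) * abs2_h X k w)); last first.
  by apply/funext => w; rewrite big_cons opprD mulNr addrAC addrA.
have kA : k \notin [set j in t] :|: A by rewrite !inE negb_or kt tA ?mem_head.
split.
- apply: measurable_funD => //; apply: measurable_funM => //.
  exact: measurable_abs2_h.
- rewrite finset.set_cons -finset.setUA.
  exact: (independent_outside_add_abs2_h indX _ mS' indS' kA).
move=> c c0.
have -> : [set w | c < S w - \sum_(j <- k :: t) b j * abs2_h X j w] =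
    [set w | c < (S w - \sum_(j <- t) b j * abs2_h X j w) + (- b k) * abs2_h X k w].
  by apply/funext => w; rewrite /= big_cons opprD mulNr addrAC addrA.
rewrite (tail_sub_abs2_h indX lawX mS' indS' kA Pw_gt0 (b0 k) tailS' c0).
congr _%:E; apply: eq_bigr => n _; rewrite big_cons.
by congr (_ * _); rewrite -mulrA; congr (_ * _); rewrite mulrC.
Qed.

End weighted_sums.

(** * The outage probability *)

(** Points are Lebesgue-null and the normal law is absolutely continuous; this makes a vanishing
    denominator negligible. *)
Lemma normal_law_set1 d (T : measurableType d) (R : realType)
    (P : probability T R) (X : {RV P >-> R}) (m s x : R) :
  has_normal_law X m s -> P (X @^-1` [set x]) = 0%E.
Proof.
move=> lawX; rewrite -[LHS]/(distribution P X [set x]) lawX//.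
have /null_content_dominatesP dom := normal_prob_dominates m s.
by apply: dom => //; exact: lebesgue_measure_set1.
Qed.

Theorem theorem1 (R : realType) (d : measure_display) (T : measurableType d)
  (P : probability T R) (K : finType) (N : {set K}) (Pw : K -> R)
  (sigma2 gth : R) (X : (K * bool)%type -> {RV P >-> R}) :
  N != finset.set0 ->
  (forall n, 0 < Pw n) ->
  {in N &, injective Pw} ->
  mutually_independent_RV X ->
  (forall i, has_normal_law (X i) 0 (Num.sqrt (2^-1))) ->
  0 <= sigma2 ->
  (0 < sigma2 \/ ~: N != finset.set0) ->
  0 < gth ->
  P [set w | sinr X Pw N sigma2 w <= gth] =
  (1 - \sum_(n in N)
         (expR (- (gth * sigma2 / Pw n)) *
          \prod_(j in N | j != n) (Pw n / (Pw n - Pw j)) *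
          \prod_(k in ~: N) (Pw n / (Pw k * gth + Pw n))))%:E.
Proof.
move=> _ Pw_gt0 Pw_inj indX lawX sigma2_ge0 sigma2_or gth_gt0.
pose num w := \sum_(n in N) abs2_h X n w * Pw n.
pose den w := \sum_(k in ~: N) abs2_h X k w * Pw k + sigma2.
(* Clearing the denominator: [gth * sigma2 < S w] says [gth * den w < num w]. *)
pose S w := \sum_(n <- enum N) Pw n * abs2_h X n w -
  \sum_(k <- enum (~: N)) (Pw k * gth) * abs2_h X k w.
have abs2_ge0 n w : 0 <= abs2_h X n w by rewrite addr_ge0// sqr_ge0.
have den_ge0 w : 0 <= den w.
  by rewrite addr_ge0// sumr_ge0// => k _; rewrite mulr_ge0// ltW.
have SE w : S w = num w - gth * (den w - sigma2).
  rewrite /S /num /den addrK !big_enum mulr_sumr; congr (_ - _).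
    by apply: eq_bigr => n _; rewrite mulrC.
  by apply: eq_bigr => k _; ring.
have [mS tailS] : measurable_fun [set: T] S /\
    P [set w | gth * sigma2 < S w] = (\sum_(n <- enum N)
      \prod_(j <- enum N | j != n) (Pw n / (Pw n - Pw j)) *
      \prod_(k <- enum (~: N)) (Pw n / (Pw k * gth + Pw n)) *
      expR (- (gth * sigma2 / Pw n)))%:E.
  have enum_inj : {in enum N &, injective Pw}.
    by move=> i j; rewrite !mem_enum; exact: Pw_inj.
  have [mS0 indS0 tailS0] :=
    tail_sum_abs2_h indX lawX Pw_gt0 (enum_uniq _) enum_inj.
  have tailS0' c : 0 <= c ->
      P [set w | c < \sum_(n <- enum N) Pw n * abs2_h X n w] =
      (\sum_(n <- enum N) \prod_(j <- enum N | j != n) (Pw n / (Pw n - Pw j)) *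
         expR (- (c / Pw n)))%:E.
    by move=> c0; rewrite tailS0 ltNge c0.
  have b_ge0 k : 0 <= Pw k * gth by rewrite mulr_ge0// ltW.
  have notinN : {in enum (~: N), forall k, k \notin [set j in enum N]%SET}.
    by move=> k; rewrite mem_enum !inE mem_enum.
  have [mS _ tailS] := tail_sub_sum_abs2_h indX lawX Pw_gt0 mS0 indS0 tailS0'
    b_ge0 (enum_uniq (~: N)) notinN.
  by split => //; apply: tailS; rewrite mulr_ge0// ltW.
have mL : measurable [set w | gth * sigma2 < S w].
  by rewrite -[X in measurable X]setTI; apply: (measurable_fun_ltr _ mS).
have mden : measurable_fun [set: T] den.
  rewrite (_ : den = fun w =>
      \sum_(k <- enum (~: N)) abs2_h X k w * Pw k + sigma2); last first.
    by apply/funext => w; rewrite big_enum.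
  apply: measurable_funD => //; apply: measurable_sum => k.
  by apply: measurable_funM => //; exact: measurable_abs2_h.
have mZ : measurable (den @^-1` [set 0]).
  by rewrite -[X in measurable X]setTI; exact: mden.
have PZ : P (den @^-1` [set 0]) = 0%E.
  (* Either the noise keeps [den] positive, or some interferer [k] exists and [den w = 0] forces the
     real part of [h_k] to be 0. *)
  have [sigma2_gt0|[k kN]] : 0 < sigma2 \/ exists k, k \in ~: N.
  - by case: sigma2_or => [|/finset.set0Pn]; [left|right].
  - rewrite (_ : den @^-1` _ = set0) ?measure0//; apply/seteqP; split => // w /= /eqP.
    by rewrite gt_eqF// ltr_wpDl// sumr_ge0// => k _; rewrite mulr_ge0// ltW.
  apply: (@subset_measure0 _ _ _ P _ (X (k, true) @^-1` [set 0])) => //.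
  - move=> w /= /eqP; rewrite paddr_eq0//; last first.
      by rewrite sumr_ge0// => j _; rewrite mulr_ge0// ltW.
    move=> /andP[+ _]; rewrite psumr_eq0 => [/allP/(_ k)|j _]; last first.
      by rewrite mulr_ge0// ltW.
    rewrite mem_index_enum kN /= mulf_eq0 (gt_eqF (Pw_gt0 k)) orbF => /(_ isT).
    by rewrite paddr_eq0 ?sqr_ge0// sqrf_eq0 => /andP[/eqP].
  - exact: normal_law_set1 (lawX _).
(* Division by zero gives 0, so the outcomes with [den w = 0] count as outages whatever [S w] is;
   hence the union with that null event. *)
have -> : [set w | sinr X Pw N sigma2 w <= gth] =
    ~` [set w | gth * sigma2 < S w] `|` den @^-1` [set 0].
  apply/seteqP; split => w /=; rewrite /sinr -/(num w) -/(den w).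
    have [d0|d0] := eqVneq (den w) 0; first by right.
    rewrite ler_pdivrMr ?lt_def ?d0 ?den_ge0// => h.
    by left; rewrite SE => h'; lra.
  case=> [/negP|->]; last by rewrite invr0 mulr0 ltW.
  have [->|d0] := eqVneq (den w) 0; first by rewrite invr0 mulr0 ltW.
  rewrite -leNgt ler_pdivrMr ?lt_def ?d0 ?den_ge0// SE => h; lra.
apply: etrans (measureU0 (measurableC mL) mZ PZ) _.
apply: etrans (probability_setC P mL) _; rewrite tailS -EFinB.
congr (_ - _)%:E; rewrite big_enum /=; apply: eq_bigr => n _.
by rewrite big_enum_cond /= big_enum /= mulrC mulrA.
Qed.
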